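(* Suppose the $n$ agents are partitioned into three nonempty groups: a group whose agents all have the same monotone cost function $C_1$, a group whose agents all have the same additive $2$-ratio-bounded cost function $C_2$, and a group consisting of a single agent with a monotone cost function $C_3$. Then a full tEFX allocation of the chores $[m]$ exists.
   Context: A cost function $C:2^{[m]}\to\mathbb{R}_{\ge0}$ is monotone if $C(S\cup\{c\})\ge C(S)$; additive if $C(S)=\sum_{c\in S}C(\{c\})$; $2$-ratio-bounded if $\max_b C(\{b\})\le 2\min_b C(\{b\})$ with positive single-chore costs. A full allocation $X=(X_1,\dots,X_n)$ (a partition of $[m]$, bundle $X_i$ to agent $i$ with cost function $C_i$) is tEFX if for all agents $i,j$ and every $c\in X_i$, $C_i(X_i\setminus\{c\})\le C_i(X_j\cup\{c\})$. *)

(* Defs.v *)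
From mathcomp Require Import all_boot all_order all_algebra.
Set Implicit Arguments. Unset Strict Implicit. Unset Printing Implicit Defensive.
Import Order.TTheory GRing.Theory Num.Theory.
Local Open Scope ring_scope.

Definition cost_fun (R : realFieldType) (m : nat) := {set 'I_m} -> R.

Definition nonneg_cost (R : realFieldType) m (C : cost_fun R m) : Prop :=
  forall S, 0 <= C S.

Definition monotone_cost (R : realFieldType) m (C : cost_fun R m) : Prop :=
  forall (S : {set 'I_m}) (c : 'I_m), C S <= C (c |: S).

Definition additive_cost (R : realFieldType) m (C : cost_fun R m) : Prop :=
  forall S : {set 'I_m}, C S = \sum_(c in S) C [set c].

Definition ratio2_bounded (R : realFieldType) m (C : cost_fun R m) : Prop :=
  (forall b : 'I_m, 0 < C [set b]) /\
  (forall a b : 'I_m, C [set a] <= 2 * C [set b]).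

Definition full_allocation n m (X : 'I_n -> {set 'I_m}) : Prop :=
  (forall i j : 'I_n, i != j -> [disjoint X i & X j]) /\
  (\bigcup_(i < n) X i = [set: 'I_m]).

Definition tEFX (R : realFieldType) n m (C : 'I_n -> cost_fun R m)
  (X : 'I_n -> {set 'I_m}) : Prop :=
  forall (i j : 'I_n) (c : 'I_m), c \in X i ->
    C i (X i :\ c) <= C i (c |: X j).

(* Main.v *)
(* The single agent chooses first, so it suffices to find a partition that works
   whatever that agent takes: with p agents of cost C1 and q agents of cost C2,
   every bundle is tEFX-feasible for C1 or for C2, more than p are feasible for
   C1 and more than q for C2.  For C2, feasibility of a bundle only says that its
   load exceeds the least load by at most twice its cheapest item ([light]).

   Rank the bundles by C1, ties broken by cardinality, and take a partition that
   is leximin-maximal for this rank among those where every bundle is feasible or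
   light and more than q are light.  If at most p bundles are feasible, the others
   form a set N of light bundles.  Let A be the lowest bundle to which some bundle
   of N would improve by giving an item, and give that item to A.  Each bundle of N
   that has stopped being light then gives one item to the least loaded bundle
   and, by the ratio bound, is light again.  A remaining bundle that is neither
   feasible nor light gives an item either to the bundle it envies or, if that
   would spoil a light one, to the least loaded bundle.  Every bundle touched on
   the way ends above the lowest initial rank of a touched bundle, so leximin has
   increased: a contradiction. *)
Require Import Defs.
From mathcomp Require Import all_boot all_order all_algebra.
From mathcomp Require Import zify lra.
Import Order.TTheory GRing.Theory Num.Theory.
Local Open Scope ring_scope.

Set Implicit Arguments.
Unset Strict Implicit.
Unset Printing Implicit Defensive.

(** * Assignments of items to bundles, and the transfer of one item *)

Section Assignments.
Variables E T : finType.
Implicit Types (f X Y : {ffun E -> T}) (S : {set E}) (c d : E) (i j k t : T).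

Definition bundle f k : {set E} := [set c | f c == k].

Definition give f d t : {ffun E -> T} := [ffun c => if c == d then t else f c].

Lemma bundle_give_recipient f d t : bundle (give f d t) t = d |: bundle f t.
Proof. by apply/setP=> c; rewrite !inE ffunE; case: (eqVneq c d) => //=; rewrite eqxx. Qed.

Lemma bundle_give_donor f d t :
  t != f d -> bundle (give f d t) (f d) = bundle f (f d) :\ d.
Proof.
by move=> td; apply/setP=> c; rewrite !inE ffunE; case: (eqVneq c d) => //= _; apply/negbTE.
Qed.

Lemma bundle_give_other f d t i :
  i != t -> i != f d -> bundle (give f d t) i = bundle f i.
Proof.
move=> it id; apply/setP=> c; rewrite !inE ffunE; case: (eqVneq c d) => // ->.
by rewrite eq_sym (negbTE it) eq_sym (negbTE id).
Qed.

(** * Feasibility and leximin improvement for a strictly monotone key *)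

Section Key.
Variable key : {set E} -> nat.
Hypothesis key_add : forall S c, c \notin S -> (key S < key (c |: S))%N.

Lemma key_addW S c : (key S <= key (c |: S))%N.
Proof.
by case: (boolP (c \in S)) => [cS|/key_add/ltnW//]; rewrite (setUidPr _) ?sub1set.
Qed.

Lemma key_rem S c : (key (S :\ c) <= key S)%N.
Proof.
case: (boolP (c \in S)) => [cS|cS].
  by rewrite -{2}(setD1K cS) key_addW.
by rewrite (setDidPl _) // disjoint_sym disjoints1.
Qed.

(** For the key [cost_rank C] this implies tEFX-feasibility under [C], by [cost_rank_le]. *)
Definition feasible f k :=
  [forall c in bundle f k, forall j,
    (key (bundle f k :\ c) <= key (c |: bundle f j))%N].

Lemma not_feasible f k : ~~ feasible f k ->
  exists d j, [/\ f d = k, j != k &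
    (key (d |: bundle f j) < key (bundle f k :\ d))%N].
Proof.
case/forall_inPn=> d; rewrite inE => /eqP dk /forallPn[j].
rewrite -ltnNge => lt; exists d, j; split=> //.
apply: contraTneq lt => ->; rewrite -leqNgt.
exact: leq_trans (key_rem _ _) (key_addW _ _).
Qed.

Definition top := (\max_(S : {set E}) key S)%N.

Lemma key_top S : (key S <= top)%N.
Proof. exact: leq_bigmax. Qed.

(* Minimising this base-[#|T|.+1] weight is maximising the increasingly sorted
   vector of keys lexicographically. *)
Definition potential f := (\sum_k #|T|.+1 ^ (top - key (bundle f k)))%N.

(** A certificate of leximin increase that survives further transfers, at the price of lowering the
    threshold [a]. *)
Definition raises (a : nat) X Y :=
  (forall k, bundle Y k = bundle X k \/
     (a <= key (bundle X k) /\ a < key (bundle Y k))%N) /\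
  (exists k, key (bundle X k) = a /\ (a < key (bundle Y k))%N).

(** The changed bundles of [Y] together weigh at most [#|T| * #|T|.+1 ^ (top - a).-1], less than the
    term of one bundle of key [a] in [X]. *)
Lemma raises_potential a X Y : raises a X Y -> (potential Y < potential X)%N.
Proof.
move=> [mv [k0 [k0a k0Y]]].
pose P k := bundle Y k == bundle X k.
rewrite /potential (bigID P) [ltnRHS](bigID P) /=.
rewrite (eq_bigr (fun k => #|T|.+1 ^ (top - key (bundle X k)))%N); last by move=> k /eqP->.
rewrite ltn_add2l.
have lt_a : (a < top)%N := leq_trans k0Y (key_top _).
have nPk0 : ~~ P k0 by apply/eqP=> e; move: k0Y; rewrite e k0a ltnn.
apply: (@leq_trans (#|T|.+1 ^ (top - a))%N); last first.
  by rewrite (bigD1 k0) //= k0a leq_addr.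
apply: (@leq_ltn_trans (\sum_(k : T) #|T|.+1 ^ (top - a).-1)%N).
  rewrite big_mkcond /=; apply: leq_sum => k _; case: ifPn => // nPk.
  case: (mv k) => [/eqP e|[_ lt]]; first by rewrite -/(P k) (negbTE nPk) in e.
  by apply: leq_pexp2l => //; lia.
have -> : (top - a = (top - a).-1.+1)%N by lia.
by rewrite sum_nat_const expnS /= ltn_mul2r expn_gt0 /= ltnS.
Qed.

Lemma raises_give X d t : t != X d ->
  (key (bundle X t) < key (bundle X (X d) :\ d))%N ->
  raises (key (bundle X t)) X (give X d t).
Proof.
move=> td lt.
have dXt : d \notin bundle X t by rewrite inE eq_sym.
split; last first.
  by exists t; rewrite bundle_give_recipient key_add.
move=> k; case: (eqVneq k t) => [->|kt].
  by right; rewrite bundle_give_recipient key_add.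
case: (eqVneq k (X d)) => [->|kd]; last by left; rewrite bundle_give_other.
right; rewrite bundle_give_donor //; split=> //.
exact: leq_trans (ltnW lt) (key_rem _ _).
Qed.

Lemma raises_give_trans a X Y d t : raises a X Y -> t != Y d ->
  (minn a (key (bundle Y t)) < key (bundle Y (Y d) :\ d))%N ->
  raises (minn a (key (bundle Y t))) X (give Y d t).
Proof.
move=> [mv [k0 [k0a k0Y]]] td lt; set b := minn _ _ in lt *.
have dYt : d \notin bundle Y t by rewrite inE eq_sym.
have gt : (key (bundle Y t) < key (bundle (give Y d t) t))%N.
  by rewrite bundle_give_recipient key_add.
have mv' k : bundle (give Y d t) k = bundle X k \/
     (b <= key (bundle X k) /\ b < key (bundle (give Y d t) k))%N.
  case: (eqVneq k t) => [->|kt].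
    by right; case: (mv t) => [<-|[]]; rewrite /b; lia.
  case: (eqVneq k (Y d)) => [->|kd].
    right; rewrite bundle_give_donor //; split=> //.
    have := key_rem (bundle Y (Y d)) d.
    by case: (mv (Y d)) => [<-|[]]; move: lt; rewrite /b; lia.
  rewrite bundle_give_other //.
  by case: (mv k) => [->|[]]; [left|right; rewrite /b; lia].
split=> //.
case: (leqP a (key (bundle Y t))) => [ab|ba].
  exists k0; have -> : b = a by rewrite /b; lia.
  split=> //; case: (eqVneq k0 t) => [->|kt]; first exact: leq_ltn_trans gt.
  case: (eqVneq k0 (Y d)) => [->|kd]; last by rewrite bundle_give_other.
  by rewrite bundle_give_donor //; move: lt; rewrite /b; lia.
(* Changed bundles have key above [a], so [t], lying below [a], is still as in [X] and witnesses the
   new threshold. *)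
exists t; have -> : b = key (bundle Y t) by rewrite /b; lia.
by split=> //; case: (mv t) => [->|[]] //; lia.
Qed.


(** At a minimum of the potential no violation remains: giving the offending item to the envied
    bundle would lower it. *)
Lemma feasible_exists (k0 : T) : exists f, forall k, feasible f k.
Proof.
pose f := [arg min_(f < [ffun=> k0] : {ffun E -> T}) potential f].
exists f => k; rewrite /f; case: arg_minnP => // {}f _ fmin.
apply/negPn/negP=> /not_feasible[d [j [<- jd lt]]].
have := raises_potential (raises_give jd (leq_ltn_trans (key_addW _ d) lt)).
by rewrite ltnNge fmin.
Qed.

(** * Additive loads under the ratio bound, and light bundles *)

Section Load.
Variables (R : realFieldType) (w : E -> R).
Hypothesis w_ratio : forall c d, w c <= 2 * w d.

Definition load f k : R := \sum_(c in bundle f k) w c.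

Definition light f k :=
  [forall c in bundle f k, forall j, load f k <= load f j + 2 * w c].

Lemma w_ge0 c : 0 <= w c.
Proof. by have := w_ratio c c; lra. Qed.

Lemma lightP f k :
  reflect (forall c j, f c = k -> load f k <= load f j + 2 * w c) (light f k).
Proof.
apply: (iffP forall_inP) => [H c j fc|H c]; first by apply: (forallP (H c _)); rewrite inE fc.
by rewrite inE => /eqP fc; apply/forallP => j; apply: H.
Qed.

Lemma not_light f k : ~~ light f k ->
  exists c j, f c = k /\ load f j + 2 * w c < load f k.
Proof.
case/forall_inPn=> c; rewrite inE => /eqP fc /forallPn[j]; rewrite -ltNge => lt.
by exists c, j.
Qed.

Lemma eq_load f g k : bundle f k = bundle g k -> load f k = load g k.
Proof. by rewrite /load => ->. Qed.

Lemma loadD1 f c k : f c = k ->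
  load f k = w c + \sum_(d in bundle f k :\ c) w d.
Proof. by move=> fc; rewrite /load (big_setD1 c) // inE fc. Qed.

Lemma load_give_recipient f d t : t != f d -> load (give f d t) t = load f t + w d.
Proof.
move=> td; rewrite /load bundle_give_recipient big_setU1 /= 1?addrC //.
by rewrite inE eq_sym.
Qed.

Lemma load_give_donor f d t :
  t != f d -> load (give f d t) (f d) = load f (f d) - w d.
Proof.
move=> td; rewrite /load bundle_give_donor // [in RHS](big_setD1 d) ?inE //=.
by rewrite addrAC subrr add0r.
Qed.

Lemma load_give_other f d t i :
  i != t -> i != f d -> load (give f d t) i = load f i.
Proof. by move=> it id; rewrite /load bundle_give_other. Qed.

Lemma exists_min_load f k : exists l, forall j, load f l <= load f j.
Proof.
exists [arg min_(l < k) load f l]%O.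
by case: arg_minP => // l _ H j; apply: H.
Qed.

Lemma min_load_light f l : (forall j, load f l <= load f j) -> light f l.
Proof.
by move=> lmin; apply/lightP=> c j _; have := lmin j; have := w_ge0 c; lra.
Qed.

(* The donor exceeds [mu] by more than [2 * w c >= w d] for some [c]. *)
Lemma load_give_ge f d t mu : ~~ light f (f d) -> t != f d ->
  (forall j, mu <= load f j) -> forall j, mu <= load (give f d t) j.
Proof.
move=> /not_light[c [i [_ lt]]] td ge j.
case: (eqVneq j t) => [->|jt].
  by rewrite load_give_recipient //; have := ge t; have := w_ge0 d; lra.
case: (eqVneq j (f d)) => [->|jd]; last by rewrite load_give_other.
by rewrite load_give_donor //; have := w_ratio d c; have := ge i; lra.
Qed.

(** The load of [i] is unchanged, and by [load_give_ge] no load falls below the old minimum. *)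
Lemma light_give f d t i : ~~ light f (f d) -> t != f d -> i != t ->
  light f i -> light (give f d t) i.
Proof.
move=> nl td it li; have id : i != f d by apply: contraNneq nl => <-.
have [l lmin] := exists_min_load f t.
apply/lightP=> c j; rewrite ffunE; case: (eqVneq c d) => [_ ti|cd fc].
  by rewrite ti eqxx in it.
rewrite load_give_other //; have := load_give_ge nl td lmin j.
by move/lightP: li => /(_ c l fc); lra.
Qed.

Lemma light_give_min f d l : ~~ light f (f d) ->
  (forall j, load f l <= load f j) -> l != f d /\ light (give f d l) l.
Proof.
move=> nl lmin; have ld : l != f d.
  by apply: contraNneq nl => <-; apply: min_load_light.
split=> //; apply/lightP=> c j _; rewrite load_give_recipient //.
by have := load_give_ge nl ld lmin j; have := w_ratio d c; lra.
Qed.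

(* Only bundles outside the set of safe ones (light, and above the threshold [a])
   are spoiled: each transfer either puts an item into a safe bundle or lowers
   the potential. *)
Lemma settle X a Y (N : {set T}) : raises a X Y ->
  {in N, forall i, light Y i /\ (a <= key (bundle Y i))%N} ->
  exists a' Z, [/\ raises a' X Z, {in N, forall i, light Z i} &
    forall k, feasible Z k || light Z k].
Proof.
pose safe a Y i := light Y i && (a <= key (bundle Y i))%N.
(* Outer induction on the number of items in unsafe bundles, inner one on the potential. *)
have [v] := ubnP #|[set c | ~~ safe a Y (Y c)]|.
elim/ltn_ind: v a Y => v IHv a Y.
have [p] := ubnP (potential Y).
elim/ltn_ind: p a Y => p IHp a Y Yp Yv rY NY.
case: (boolP [forall k, feasible Y k || light Y k]) => [/forallP all_ok|].
  by exists a, Y; split=> // i /NY[].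
case/forallPn=> k; rewrite negb_or => /andP[/not_feasible[d [j [dk jk viol]]] nlk].
rewrite -{}dk in jk viol nlk.
have lt_j : (key (bundle Y j) < key (bundle Y (Y d) :\ d))%N.
  exact: leq_ltn_trans (key_addW _ d) viol.
have safe_give t i : t != Y d -> i != t -> safe a Y i ->
    safe (minn a (key (bundle Y t))) (give Y d t) i.
  move=> td it /andP[li ai]; rewrite /safe light_give //=.
  have id : i != Y d by apply: contraNneq nlk => <-.
  by rewrite bundle_give_other //; lia.
have sub t : t != Y d ->
    (safe a Y t -> safe (minn a (key (bundle Y t))) (give Y d t) t) ->
    [set c | ~~ safe (minn a (key (bundle Y t))) (give Y d t) (give Y d t c)]
      \subset [set c | ~~ safe a Y (Y c)].
  move=> td st; apply/subsetP=> c; rewrite !inE ffunE; case: eqP => [-> _|_].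
    by rewrite /safe negb_and nlk.
  apply: contra => sc; case: (eqVneq (Y c) t) => [ct|ct]; last exact: safe_give.
  by rewrite ct; apply: st; rewrite -ct.
have Nsafe a' Z : (forall i, safe a Y i -> safe a' Z i) ->
    {in N, forall i, light Z i /\ (a' <= key (bundle Z i))%N}.
  by move=> H i /NY[li ai]; apply/andP/H/andP.
(* A safe [j] could be spoiled, so [d] goes to the least loaded bundle, which becomes safe: fewer
   items are unsafe. The donor keeps a key above that of [j], hence above [a]. *)
case: (boolP (safe a Y j)) => [/andP[lj aj]|nsj].
  have [l lmin] := exists_min_load Y k.
  have [ld ll] := light_give_min nlk lmin.
  have sl : safe (minn a (key (bundle Y l))) (give Y d l) l.
    by rewrite /safe ll bundle_give_recipient /=; have := key_addW (bundle Y l) d; lia.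
  have sgl i : safe a Y i -> safe (minn a (key (bundle Y l))) (give Y d l) i.
    by case: (eqVneq i l) => [->|il] // /safe_give; apply.
  apply: (IHv _ _ (minn a (key (bundle Y l))) (give Y d l) (leqnn _)).
  - apply: leq_trans Yv; rewrite ltnS; apply: proper_card.
    rewrite properE sub //=; apply/subsetPn; exists d; rewrite inE.
      by rewrite /safe negb_and nlk.
    by rewrite ffunE eqxx sl.
  - by apply: raises_give_trans => //; lia.
  - exact: Nsafe.
(* An unsafe [j] has nothing to lose: giving it [d] adds no unsafe item and lowers the potential. *)
have sgj i : safe a Y i -> safe (minn a (key (bundle Y j))) (give Y d j) i.
  by case: (eqVneq i j) => [->|ij]; [rewrite (negbTE nsj) | apply: safe_give].
apply: (IHp _ _ (minn a (key (bundle Y j))) (give Y d j) (leqnn _)).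
- apply: leq_trans Yp; rewrite ltnS; exact: raises_potential (raises_give jk lt_j).
- apply: leq_ltn_trans Yv; apply: subset_leq_card; exact: sub (sgj j).
- by apply: raises_give_trans => //; lia.
- exact: Nsafe.
Qed.

(* [z] is the only bundle whose load may lie more than one item below [mu]; after
   each transfer this role passes to the donor. *)
Lemma lighten X (N : {set T}) mu a0 a Y z :
  (forall j, mu <= load X j) ->
  {in N, forall i c, X c = i -> load X i <= mu + 2 * w c} ->
  {in N, forall i, exists2 d, X d = i & (a0 < key (bundle X i :\ d))%N} ->
  raises a X Y -> (a <= a0)%N ->
  {in N, forall i, light Y i \/ bundle Y i = bundle X i} ->
  (forall c j, j != z -> mu - w c <= load Y j) ->
  (forall c, mu - 2 * w c <= load Y z) ->
  exists a' Z, [/\ raises a' X Z, (a' <= a0)%N & {in N, forall i, light Z i}].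
Proof.
move=> mu_le Nmu Nrem.
have [v] := ubnP #|[set i in N | ~~ light Y i]|.
elim: v a Y z => // v IHv a Y z Yv rY aa0 NY Yz Zz.
case: (boolP [forall (i | i \in N), light Y i]) => [/forall_inP NL|].
  by exists a, Y; split=> // i /NL.
case/forall_inPn=> i iN nl.
have Yi : bundle Y i = bundle X i by case: (NY i iN) => // li; rewrite li in nl.
have [d Xd a0d] := Nrem i iN.
have Yd : i = Y d.
  have : d \in bundle Y i by rewrite Yi inE Xd.
  by rewrite inE => /eqP.
have nlYd : ~~ light Y (Y d) by rewrite -Yd.
have [l lmin] := exists_min_load Y i.
have [ld ll] := light_give_min nlYd lmin.
have li : l != i by rewrite Yd.
have XYi : load Y i = load X i by apply: eq_load.
have gi : load (give Y d l) i = load X i - w d.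
  by rewrite {1}Yd load_give_donor // -Yd XYi.
have rest c j : j != i -> mu - w c <= load (give Y d l) j.
  move=> ji; case: (eqVneq j l) => [->|jl].
    rewrite load_give_recipient //; have wd := w_ge0 d.
    case: (eqVneq l z) => [->|lz]; last by have := Yz c l lz; lra.
    (* The bound on [z] is used with the lighter of [c] and [d]. *)
    by have := Zz c; have := Zz d; case: (leP (w c) (w d)); lra.
  rewrite load_give_other -?Yd //.
  (* The old exception [z] is no lower than the minimum [l], which obeys the ordinary bound. *)
  case: (eqVneq j z) => [jz|]; last exact: Yz.
  have lz : l != z by rewrite -jz eq_sym.
  by have := Yz c l lz; have := lmin j; lra.
(* The load of [i] is now at most [mu + 2 * w c - w d], while every other load is at least
   [mu - w d]. *)
have lgi : light (give Y d l) i.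
  apply/lightP=> c j; rewrite ffunE gi; case: (eqVneq c d) => [_ e|cd Yc].
    by rewrite e eqxx in li.
  case: (eqVneq j i) => [->|ji]; first by rewrite gi; have := w_ge0 c; lra.
  have Xc : X c = i.
    have : c \in bundle X i by rewrite -Yi inE Yc.
    by rewrite inE => /eqP.
  by have := Nmu i iN c Xc; have := rest d j ji; lra.
have keep j : light Y j -> light (give Y d l) j.
  by case: (eqVneq j l) => [->|jl] // /light_give; apply.
apply: (IHv (minn a (key (bundle Y l))) (give Y d l) i).
- rewrite -ltnS; apply: leq_trans Yv; rewrite ltnS; apply: proper_card.
  apply/properP; split.
    by apply/subsetP=> j; rewrite !inE => /andP[-> /=]; apply/contra/keep.
  by exists i; rewrite !inE iN ?lgi.
- by apply: raises_give_trans => //; rewrite -Yd Yi; lia.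
- by lia.
- move=> j jN; case: (eqVneq j i) => [->|ji]; first by left.
  case: (NY j jN) => [/keep|e]; first by left.
  case: (eqVneq j l) => [->|jl]; first by left.
  by right; rewrite bundle_give_other -?Yd.
- exact: rest.
- by move=> c; rewrite gi; have := mu_le i; have := w_ratio d c; lra.
Qed.

Lemma improve X :
  (forall k, feasible X k || light X k) -> (exists k, ~~ feasible X k) ->
  exists Z, [/\ (potential Z < potential X)%N,
    forall k, feasible Z k || light Z k &
    forall k, ~~ feasible X k -> light Z k].
Proof.
move=> cover [k0 nf0].
pose envied j := [exists d, key (d |: bundle X j) < key (bundle X (X d) :\ d)]%N.
have enviedP i : ~~ feasible X i -> exists d j,
    [/\ X d = i, j != i, envied j & (key (bundle X j) < key (bundle X i :\ d))%N].
  move=> /not_feasible[d [j [Xd ji lt]]]; exists d, j; split=> //.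
    by apply/existsP; exists d; rewrite Xd.
  exact: leq_ltn_trans (key_addW _ _) lt.
have [_ [j0 [_ _ ej0 _]]] := enviedP k0 nf0.
pose A := [arg min_(j < j0 | envied j) key (bundle X j)].
have [eA Amin] : envied A /\ forall j, envied j -> (key (bundle X A) <= key (bundle X j))%N.
  by rewrite /A; case: arg_minnP.
case/existsP: (eA) => b lt_b.
have lt_Ab : (key (bundle X A) < key (bundle X (X b) :\ b))%N.
  exact: leq_ltn_trans (key_addW _ _) lt_b.
have Ab : A != X b.
  apply: contraTneq lt_Ab => ->; rewrite -leqNgt; exact: key_rem.
pose N := [set k | ~~ feasible X k].
(* A bundle of [N] envies one of strictly smaller key, so its key exceeds that of [A]. *)
have NA i : i \in N -> i != A.
  rewrite inE => /enviedP[d [j [_ _ ej lt]]]; apply: contraTneq lt => ->.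
  by rewrite -leqNgt (leq_trans (key_rem _ _)) // Amin.
have Nlight i : i \in N -> light X i.
  by rewrite inE => nf; have := cover i; rewrite (negbTE nf).
have bN : X b \in N.
  rewrite inE; apply/forall_inPn; exists b; rewrite ?inE //.
  by apply/forallPn; exists A; rewrite -ltnNge.
have [l lmin] := exists_min_load X A.
have r1 := raises_give Ab lt_Ab.
have [||||c j jb|c|a [Y [rY aA NY]]] := @lighten X N (load X l) (key (bundle X A)) _ _ (X b) lmin _ _ r1.
- by move=> i /Nlight/lightP H c; apply: H.
- move=> i; rewrite inE => /enviedP[d [j [Xd _ ej lt]]]; exists d => //.
  exact: leq_ltn_trans (Amin _ ej) lt.
- exact: leqnn.
(* Only the donor's load falls, so the donor stays light; the other bundles of [N] are untouched. *)
- move=> i iN; case: (eqVneq i (X b)) => [->|ib]; last by right; rewrite bundle_give_other // NA.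
  left; apply/lightP=> c j; rewrite ffunE; case: (eqVneq c b) => [_ e|cb Xc].
    by rewrite e eqxx in Ab.
  rewrite load_give_donor //; have := w_ge0 b; have := w_ge0 c.
  case: (eqVneq j (X b)) => [->|jb]; first by rewrite load_give_donor //; lra.
  have /lightP/(_ c j Xc) := Nlight _ bN.
  case: (eqVneq j A) => [->|jA]; first by rewrite load_give_recipient //; lra.
  by rewrite load_give_other //; lra.
- have := lmin j; have := w_ge0 b; have := w_ge0 c.
  case: (eqVneq j A) => [->|jA]; first by rewrite load_give_recipient //; lra.
  by rewrite load_give_other //; lra.
- by rewrite load_give_donor //; have := lmin (X b); have := w_ratio b c; lra.
(* Each bundle of [N] is above the threshold: by [raises] if changed, otherwise because its key
   exceeds that of [A]. *)
have [|a' [Z [rZ NZ coverZ]]] := @settle X a Y N rY.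
  move=> i iN; split; first exact: NY.
  case: rY => mv _; case: (mv i) => [->|[_ /ltnW] //].
  apply: leq_trans aA _; move: (iN); rewrite inE => /enviedP[d [j [_ _ ej lt]]].
  exact: leq_trans (leq_trans (Amin _ ej) (ltnW lt)) (key_rem _ _).
exists Z; split=> // [|k nf]; first exact: raises_potential rZ.
by apply: NZ; rewrite inE.
Qed.

Lemma universal_partition (p q : nat) : (p + q < #|T|)%N ->
  (exists f, forall k, light f k) ->
  exists f, [/\ forall k, feasible f k || light f k,
    (p < #|[set k | feasible f k]|)%N & (q < #|[set k | light f k]|)%N].
Proof.
move=> pqT [f0 lf0].
pose K f := [forall k, feasible f k || light f k] && (q < #|[set k | light f k]|)%N.
have K0 : K f0.
  apply/andP; split; first by apply/forallP=> k; rewrite lf0 orbT.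
  rewrite (_ : [set k | _] = setT) ?cardsT; first by lia.
  by apply/setP=> k; rewrite !inE lf0.
pose f := [arg min_(f < f0 | K f) potential f].
have [/andP[/forallP cover ql] fmin] : K f /\ forall g, K g -> (potential f <= potential g)%N.
  by rewrite /f; case: arg_minnP.
exists f; split=> //; rewrite ltnNge; apply/negP=> few.
have cN : (q < #|[set k | ~~ feasible f k]|)%N.
  have -> : [set k | ~~ feasible f k] = ~: [set k | feasible f k].
    by apply/setP=> k; rewrite !inE.
  by have := cardsC [set k | feasible f k]; lia.
have [k] : exists k, k \in [set k | ~~ feasible f k] by apply/card_gt0P; lia.
rewrite inE => nf.
have [|Z [lt coverZ NZ]] := improve cover; first by exists k.
(* More than [q] bundles were infeasible in [f], and all of them are light in [Z]. *)
have : K Z.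
  apply/andP; split; first exact/forallP.
  apply: leq_trans cN _; apply: subset_leq_card.
  by apply/subsetP=> i; rewrite !inE => /NZ.
by move/fmin; rewrite leqNgt lt.
Qed.

End Load.
End Key.
End Assignments.

(* List the agents as [z], [A], the rest, and the bundles as [k], [F :\: L],
   [F :&: L], [L :\: F], and match them in order. *)
Lemma matching_around (T : finType) (A F L : {set T}) (z k : T) :
  z \notin A -> F :|: L = setT ->
  (#|A| < #|F|)%N -> (#|~: (z |: A)| < #|L|)%N ->
  exists s : T -> T, [/\ injective s, s z = k, {in A, forall i, s i \in F} &
    forall i, i != z -> i \notin A -> s i \in L].
Proof.
move=> zA FL AF BL; set B := ~: (z |: A) in BL.
pose F' := F :\ k; pose L' := L :\ k.
pose s1 := enum A ++ enum B.
pose s2 := enum (F' :\: L') ++ enum (F' :&: L') ++ enum (L' :\: F').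
have mem1 i : i \in z :: s1.
  by rewrite !(inE, mem_cat, mem_enum); case: (i == z); case: (i \in A).
have mem2 i : i \in k :: s2.
  have : i \in F :|: L by rewrite FL inE.
  rewrite !(inE, mem_cat, mem_enum).
  by case: (i == k); case: (i \in F); case: (i \in L).
have cardT : #|T| = (#|A| + #|B|).+1.
  by have := cardsC (z |: A); rewrite cardsU1 zA -/B; lia.
have cardF : (#|A| <= #|F' :\: L'| + #|F' :&: L'|)%N.
  by have := cardsID L' F'; have := cardsD1 k F; rewrite -/F'; case: (k \in F); lia.
have cardL : (#|B| <= #|L'|)%N.
  by have := cardsD1 k L; rewrite -/L'; case: (k \in L); lia.
have sz1 : size (z :: s1) = #|T| by rewrite /= size_cat -!cardE cardT.
have card2 : (#|F' :\: L'| + #|L'| = #|A| + #|B|)%N.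
  have := cardsC1 k; rewrite cardT /= => <-.
  have -> : [set~ k] = L' :|: (F' :\: L').
    apply/setP=> i; have : i \in F :|: L by rewrite FL inE.
    by rewrite !inE; case: (i == k); case: (i \in F); case: (i \in L).
  rewrite cardsU (_ : L' :&: _ = set0) ?cards0; first by lia.
  by apply/setP=> i; rewrite !inE; case: (i \in L); case: (i == k).
have sz2 : size s2 = (#|A| + #|B|)%N.
  by rewrite !size_cat -!cardE; have := cardsID F' L'; rewrite setIC; lia.
have uniq_all (x : T) s : (forall i, i \in x :: s) -> size (x :: s) = #|T| -> uniq (x :: s).
  by move=> mem sz; apply/card_uniqP; rewrite sz; apply: eq_card => i; rewrite mem.
have u1 := uniq_all _ _ mem1 sz1.
have u2 : uniq (k :: s2) by apply: uniq_all => //=; rewrite sz2 cardT.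
have idx i : (index i (z :: s1) < size (k :: s2))%N.
  by rewrite [size _]/= sz2 -cardT -sz1 index_mem.
(* By [idx] the default [k] of [nth] is never reached. *)
exists (fun i => nth k (k :: s2) (index i (z :: s1))); split.
- move=> i j /eqP; rewrite nth_uniq // => /eqP e.
  by rewrite -(nth_index z (mem1 i)) e nth_index.
- by rewrite /= eqxx.
- move=> i iA; rewrite /= (_ : z == i = false); last by apply: contraNF zA => /eqP->.
  rewrite /= index_cat mem_enum iA /s2 catA nth_cat size_cat -!cardE.
  have lt : (index i (enum A) < #|F' :\: L'| + #|F' :&: L'|)%N.
    by apply: leq_trans cardF; rewrite cardE index_mem mem_enum.
  rewrite lt.
  have := @mem_nth _ k (enum (F' :\: L') ++ enum (F' :&: L')) (index i (enum A)).
  rewrite size_cat -!cardE => /(_ lt); rewrite mem_cat !mem_enum !inE.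
  by case/orP => [/and3P[] | /andP[/andP[]]].
- move=> i iz iA; have iB : i \in B by rewrite !inE negb_or iz iA.
  rewrite /= eq_sym (negbTE iz) /= index_cat mem_enum (negbTE iA) -cardE.
  have := @mem_nth _ k (enum (F' :&: L') ++ enum (L' :\: F'))
    (#|A| + index i (enum B) - #|F' :\: L'|)%N.
  have ltB : (index i (enum B) < #|B|)%N by rewrite cardE index_mem mem_enum.
  rewrite /s2 nth_cat -cardE size_cat -!cardE.
  have := cardsID F' L'; rewrite setIC => cFL.
  (* [card2] and [cardL] bound the first block by [#|A|], so these agents fall beyond it. *)
  rewrite ifF; last by apply/negbTE; rewrite -leqNgt; lia.
  have lt : (#|A| + index i (enum B) - #|F' :\: L'| < #|F' :&: L'| + #|L' :\: F'|)%N by lia.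
  move=> /(_ lt); rewrite mem_cat !mem_enum !inE.
  by case/orP => [/andP[_ /andP[]] | /and3P[_ _]].
Qed.

(** * Integer ranks for costs, and an initial light assignment *)

Section CostRank.
Variables (R : realFieldType) (E : finType) (C : {set E} -> R).

(** The tie-break by cardinality makes the rank strictly monotone even where the cost is
    constant. *)
Definition cost_rank (S : {set E}) :=
  #|[set U | (C U < C S) || ((C U == C S) && (#|U| < #|S|)%N)]|.

Lemma cost_rank_add : (forall (S : {set E}) c, C S <= C (c |: S)) ->
  forall (S : {set E}) c, c \notin S -> (cost_rank S < cost_rank (c |: S))%N.
Proof.
move=> mono S c cS; apply: proper_card; apply/properP; split.
  apply/subsetP=> U; rewrite !inE cardsU1 cS => /orP[lt|/andP[/eqP-> lt]].
    by rewrite (lt_le_trans lt).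
  by case: (ltgtP (C S) (C (c |: S))) (mono S c) => //= _ _; lia.
exists S; rewrite !inE ?ltxx ?ltnn ?andbF // cardsU1 cS.
by case: (ltgtP (C S) (C (c |: S))) (mono S c) => //= _ _; lia.
Qed.

Lemma cost_rank_le S U : (cost_rank S <= cost_rank U)%N -> C S <= C U.
Proof.
apply: contraTT; rewrite -ltNge -ltnNge => lt.
apply: proper_card; apply/properP; split.
  apply/subsetP=> V; rewrite !inE => /orP[ltV|/andP[/eqP-> _]]; last by rewrite lt.
  by rewrite (lt_trans ltV lt).
by exists U; rewrite !inE ?lt // ltxx ltnn andbF.
Qed.

End CostRank.

(** Feasibility for the rank of the additive cost [w] gives lightness. *)
Lemma light_exists (R : realFieldType) (E T : finType) (w : E -> R) (k0 : T) :
  (forall c d, w c <= 2 * w d) ->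
  exists f : {ffun E -> T}, forall k, light w f k.
Proof.
move=> w_ratio; pose C (S : {set E}) := \sum_(c in S) w c.
have mono S c : C S <= C (c |: S).
  case: (boolP (c \in S)) => cS; first by rewrite (setUidPr _) ?sub1set.
  by rewrite /C big_setU1 //= lerDr; apply: w_ge0.
have [f ff] := feasible_exists (cost_rank_add mono) k0.
exists f => k; apply/lightP => c j fc.
case: (eqVneq j k) => [->|jk]; first by have := w_ge0 w_ratio c; lra.
have := ff k => /forall_inP/(_ c); rewrite inE fc eqxx => /(_ isT)/forallP/(_ j).
move=> /cost_rank_le; rewrite /C big_setU1 /=; last by rewrite inE fc eq_sym.
by rewrite (loadD1 w fc) /load; lra.
Qed.

(** * Assembling the allocation for the three groups *)

Theorem theorem3 (R : realFieldType) (n m : nat)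
  (C1 C2 C3 : {set 'I_m} -> R) (g : 'I_n -> 'I_3) :
  nonneg_cost C1 -> nonneg_cost C2 -> nonneg_cost C3 ->
  monotone_cost C1 ->
  additive_cost C2 -> ratio2_bounded C2 ->
  monotone_cost C3 ->
  (exists i, nat_of_ord (g i) = 0%N) ->
  (exists i, nat_of_ord (g i) = 1%N) ->
  #|[set i | nat_of_ord (g i) == 2%N]| = 1%N ->
  exists X : 'I_n -> {set 'I_m},
    full_allocation X /\
    tEFX (fun i => if nat_of_ord (g i) == 0%N then C1
                   else if nat_of_ord (g i) == 1%N then C2 else C3) X.
Proof.
move=> _ _ _ mono1 add2 [_ ratio2] mono3 _ _ card2.
have [z zP] : exists z, [set i | nat_of_ord (g i) == 2%N] = [set z].
  by apply/cards1P; rewrite card2.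
have g2 i : (nat_of_ord (g i) == 2%N) = (i == z).
  by move/setP/(_ i): zP; rewrite !inE.
have gz : nat_of_ord (g z) = 2%N by apply/eqP; rewrite g2.
pose w c := C2 [set c].
have rem3 S c : C3 (S :\ c) <= C3 S.
  case: (boolP (c \in S)) => cS; first by rewrite -{2}(setD1K cS) mono3.
  by rewrite (setDidPl _) // disjoint_sym disjoints1.
pose A := [set i | nat_of_ord (g i) == 0%N].
have zA : z \notin A by rewrite inE gz.
(* The two groups together omit only [z], so [p + q = n - 1]. *)
have [|f [cover AF BL]] := @universal_partition _ 'I_n _ (cost_rank_add mono1)
  R w ratio2 #|A| #|~: (z |: A)| _ (light_exists z ratio2).
  by rewrite -(cardsC (z |: A)) cardsU1 zA; exact: leqnn.
(* Agent [z] will get a [C3]-cheapest bundle, for which monotonicity gives tEFX. *)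
have [k kmin] : exists k, forall j, C3 (bundle f k) <= C3 (bundle f j).
  exists [arg min_(k < z) C3 (bundle f k)]%O.
  by case: arg_minP => // k _ H j; apply: H.
have [|s [s_inj sz sA sB]] := @matching_around _ A _ _ z k zA _ AF BL.
  by apply/setP=> i; rewrite !inE cover.
exists (fun i => bundle f (s i)); split.
  split=> [i j ij|].
    rewrite -setI_eq0; apply/eqP/setP=> c; rewrite !inE.
    by apply: contraNF ij => /andP[/eqP-> /eqP/s_inj->].
  apply/setP=> c; rewrite inE; apply/bigcupP.
  by exists (invF s_inj (f c)); rewrite ?inE ?f_invF.
move=> i j c; case: eqP => [gi|g0].
  have : s i \in [set k | feasible (cost_rank C1) f k] by apply: sA; rewrite inE gi.
  by rewrite inE => /forall_inP H /H/forallP/(_ (s j))/cost_rank_le.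
case: eqP => [gi|g1] ci.
  have iz : i != z by rewrite -g2 gi.
  have : s i \in [set k | light w f k] by apply: sB; rewrite // inE gi.
  rewrite inE => /lightP/(_ c (s j)); rewrite inE in ci; move=> /(_ (eqP ci)).
  case: (eqVneq j i) => [-> _|ji].
    rewrite (setUidPr _) ?sub1set ?inE ?ci // add2 [leRHS]add2.
    rewrite [leRHS](big_setD1 c) ?inE ?ci //= lerDr; exact: (w_ge0 ratio2).
  rewrite [C2 (_ :\ _)]add2 [C2 (_ |: _)]add2 big_setU1 /=; last first.
    by rewrite inE (eqP ci); apply: contraNN ji => /eqP/s_inj->.
  by rewrite (loadD1 w (eqP ci)) /load /w; lra.
have iz : i = z.
  by apply/eqP; rewrite -g2; case: (g i) g0 g1 => -[|[|[]]].
rewrite iz sz; apply: le_trans (rem3 _ _) _; apply: le_trans (kmin (s j)) _; exact: mono3.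
Qed.
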